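(* For any topological space $X$, $X$ satisfies the partition relation $\Omega\rightarrow\lceil\Omega\rceil^2_2$ if and only if $X$ has property ${\sf S}_{fin}(\Omega,\Omega)$.
   Context: ''Cover'' means countable open cover. For a space $X$, a cover $\mathcal{U}$ of $X$ is an $\omega$-cover if $X\notin\mathcal{U}$ and every finite subset of $X$ is contained in some member of $\mathcal{U}$. $X$ has ${\sf S}_{fin}(\Omega,\Omega)$ if for every sequence $(\mathcal{U}_n)$ of $\omega$-covers of $X$ one can choose finite $\mathcal{V}_n\subseteq\mathcal{U}_n$ such that $\bigcup_n\mathcal{V}_n$ is an $\omega$-cover of $X$. $X$ satisfies $\Omega\rightarrow\lceil\Omega\rceil^2_2$ if for every $\omega$-cover $\mathcal{U}$ of $X$ and every coloring $f:[\mathcal{U}]^2\to\{0,1\}$ there are $i\in\{0,1\}$, an $\omega$-cover $\mathcal{V}\subseteq\mathcal{U}$ of $X$, and a finite-to-one function $q:\mathcal{V}\to\omega$ such that for all $A,B\in\mathcal{V}$ with $q(A)\neq q(B)$ we have $f(\{A,B\})=i$. *)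

(* Defs.v *)
From mathcomp Require Import all_boot all_order.
From mathcomp Require Import all_classical topology.

Set Implicit Arguments.
Unset Strict Implicit.
Unset Printing Implicit Defensive.

Local Open Scope classical_set_scope.

(* "Countable" allows finite families; an omega-cover is in any case infinite. *)
Definition countable_open_cover (X : topologicalType) (U : set (set X)) : Prop :=
  [/\ countable U, (forall A, U A -> open A) & \bigcup_(A in U) A = setT].

Definition omega_cover (X : topologicalType) (U : set (set X)) : Prop :=
  [/\ countable_open_cover U, ~ U setT &
      forall F : set X, finite_set F -> exists2 A, U A & F `<=` A].

Definition Sfin_Omega_Omega (X : topologicalType) : Prop :=
  forall U : nat -> set (set X), (forall n, omega_cover (U n)) ->
  exists V : nat -> set (set X),
    (forall n, finite_set (V n) /\ V n `<=` U n) /\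
    omega_cover (\bigcup_n V n).

Definition finite_to_one_on (T : Type) (V : set T) (q : T -> nat) : Prop :=
  forall n, finite_set [set A | V A /\ q A = n].

(* The relation Omega -> |Omega|^2_2 (ceiling brackets).  A colouring of the
   two-element subsets of U is given by a total function on sets of subsets of
   X, and q by a total function on subsets of X.  Only the values of f at pairs
   {A, B} with A and B distinct members of U, and those of q on V, matter:
   q A <> q B forces A <> B. *)
Definition Omega_arrow_ceil_Omega (X : topologicalType) : Prop :=
  forall U : set (set X), omega_cover U ->
  forall f : set (set X) -> 'I_2,
  exists (i : 'I_2) (V : set (set X)) (q : set X -> nat),
    [/\ omega_cover V, V `<=` U, finite_to_one_on V q &
        forall A B, V A -> V B -> q A <> q B -> f [set A; B] = i].

(* Main.v *)
Require Import Defs.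
From mathcomp Require Import all_boot all_order.
From mathcomp Require Import all_classical topology.
From mathcomp Require Import zify.

(** Ramsey-type arguments work because a finite union of families that are not
    omega-covers is not an omega-cover.

    From the partition relation to S_fin: let B_n enumerate U_0 and colour the
    sets B_n `&` C with C in U_n according to whether or not their indices n
    agree.  A family on which all indices agree is not an omega-cover, since it
    lies below one B_n; so the other colour occurs, the indices are then
    finite-to-one, and each U_n contributes finitely many sets C.

    From S_fin to the partition relation: enumerate U as e_0, e_1, ... and shrink
    U along a decreasing sequence of omega-covers U_n such that
    f {e_j, B} = c_j for all B in U_(j+1).  For some colour i, every
    {e_j | c_j = i} `&` U_n is an omega-cover.  Finite selections from these
    are grouped into consecutive blocks so long that non-adjacent blocks are
    homogeneous; then the union of the even blocks or the union of the odd
    blocks is an omega-cover. *)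

Set Implicit Arguments.
Unset Strict Implicit.
Unset Printing Implicit Defensive.

Local Open Scope classical_set_scope.

Section OmegaCovers.
Variable X : topologicalType.
Implicit Types U V W : set (set X).

Lemma omega_cover_subset U V : omega_cover U -> V `<=` U ->
  (forall F : set X, finite_set F -> exists2 A, V A & F `<=` A) ->
  omega_cover V.
Proof.
move=> [[cU oU _] nT _] VU cof; split=> //; last by move/VU.
split; [exact: sub_countable (subset_card_le VU) cU | by move=> A /VU /oU |].
rewrite -subTset => x _; have [A VA xA] := cof [set x] (finite_set1 x).
by exists A => //; exact: xA.
Qed.

Lemma omega_cover_between U V W : omega_cover U -> V `<=` U ->
  omega_cover W -> W `<=` V -> omega_cover V.
Proof.
move=> oU VU [_ _ cofW] WV; apply: (omega_cover_subset oU VU) => F /cofW[A WA FA].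
by exists A => //; exact: WV.
Qed.

(** If no member of [V] contains the finite set [F] and no member of [W] contains the finite set
    [G], then no member of [U] contains their union. *)
Lemma omega_cover_split U V W : omega_cover U -> V `<=` U -> W `<=` U ->
  U `<=` V `|` W -> omega_cover V \/ omega_cover W.
Proof.
move=> oU VU WU UVW; apply/or_asboolP; rewrite -implyNb.
apply/implyP => /asboolPn nV; apply/asboolP.
apply: (omega_cover_subset oU WU) => G finG; apply: contrapT => nG; apply: nV.
apply: (omega_cover_subset oU VU) => F finF.
have [_ _ /(_ (F `|` G))] := oU; rewrite finite_setU => /(_ (conj finF finG)).
move=> [A /UVW[VA|WA] FGA]; first by exists A => // x Fx; apply: FGA; left.
by case: nG; exists A => // x Gx; apply: FGA; right.
Qed.

Lemma omega_cover_nonempty U : omega_cover U -> U !=set0.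
Proof. by move=> [_ _ /(_ set0 (finite_set0 _))[A UA _]]; exists A. Qed.

Lemma omega_cover_enum U : omega_cover U ->
  exists e : nat -> set X, range e = U.
Proof.
move=> oU; have [[cU _ _] _ _] := oU; have [A0 UA0] := omega_cover_nonempty oU.
have /countable_injP[code codeI] := cU.
have injc A B : U A -> U B -> code A = code B -> A = B.
  by move=> UA UB; apply: codeI; exact/mem_set.
(* Numbers coding no member of [U] are sent to [A0], so the enumeration may repeat. *)
exists (fun n => xget A0 [set A | U A /\ code A = n]); apply/seteqP; split.
  by move=> _ [n _ <-]; case: xgetP => // A _ [].
move=> A UA; exists (code A) => //.
by case: xgetP => [B _ [UB /injc ->]|/(_ A)[]].
Qed.

Lemma omega_cover_not_below U A : omega_cover U -> A <> setT ->
  ~ (forall B, U B -> B `<=` A).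
Proof.
move=> [_ _ cof] AT below; apply: AT; rewrite -subTset => x _.
by have [B /below BA xB] := cof [set x] (finite_set1 x); apply/BA/xB.
Qed.

End OmegaCovers.

Lemma Sfin_of_arrow (X : topologicalType) :
  Omega_arrow_ceil_Omega X -> Sfin_Omega_Omega X.
Proof.
move=> arrow U oU; have [B rangeB] := omega_cover_enum (oU 0).
have UB n : U 0 (B n) by rewrite -rangeB; exists n.
have BT n : B n <> setT by move=> BnT; have [_ + _] := oU 0; apply; rewrite -BnT.
pose meets := \bigcup_n [set B n `&` C | C in U n].
have omeets : omega_cover meets.
  have cof (F : set X) : finite_set F -> exists2 A, meets A & F `<=` A.
    move=> finF; have [_ _ /(_ F finF)[D]] := oU 0.
    rewrite -rangeB => -[n _ <-] FB; have [_ _ /(_ F finF)[C UC FC]] := oU n.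
    by exists (B n `&` C); [exists n => //; exists C | rewrite subsetI].
  split=> //.
    split.
    - apply: bigcup_countable => // n _; have [[cU _ _] _ _] := oU n.
      exact: sub_countable (card_image_le _ _) cU.
    - move=> _ [n _ [C UC <-]]; have [[_ oUn _] _ _] := oU n.
      by have [[_ oU0 _] _ _] := oU 0; apply: openI; [exact: oU0 | exact: oUn].
    - rewrite -subTset => x _; have [A mA xA] := cof [set x] (finite_set1 x).
      by exists A => //; exact: xA.
  move=> [n _ [C _ BCT]]; apply: (BT n); rewrite -subTset -BCT.
  exact: subIsetl.
(* A set can be such an intersection in several ways; [p] fixes one index and one factor [C]. *)
have /choice[p pP] (A : set X) : exists p : nat * set X,
    meets A -> U p.1 p.2 /\ B p.1 `&` p.2 = A.
  have [[n _ [C UC eA]]|nmA] := pselect (meets A); first by exists (n, C).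
  by exists (0, setT).
pose f (P : set (set X)) : 'I_2 :=
  if `[< forall A D, P A -> P D -> (p A).1 = (p D).1 >] then ord0 else ord_max.
have fE A D : f [set A; D] = ord0 <-> (p A).1 = (p D).1.
  rewrite /f; case: asboolP => [same|diff]; split=> //.
    by move=> _; apply: same; [left | right].
  by move=> eqAD; case: diff => _ _ [->|->] [->|->].
have [i [V [q [oV Vm finq homV]]]] := arrow _ omeets f.
(* Otherwise the colour is [ord0]. Each [E] in [V] has a [q]-value different from that of [A] or of
   [D], hence shares their index, and all of [V] lies below one [B n]. *)
have sep A D : V A -> V D -> (p A).1 = (p D).1 -> q A = q D.
  move=> VA VD eqAD; apply: contrapT => qAD.
  have i0 : i = ord0 by rewrite -(homV A D)//; exact/fE.
  have same E : V E -> (p E).1 = (p A).1.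
    move=> VE; have [qEA|/eqP qEA] := eqVneq (q E) (q A).
      by rewrite eqAD; apply/fE; rewrite homV// qEA.
    by apply/fE; rewrite homV.
  apply: (omega_cover_not_below oV (BT (p A).1)) => E VE.
  have [_ <-] := pP E (Vm E VE); rewrite same//; exact: subIsetl.
exists (fun n => [set (p A).2 | A in V `&` [set A | (p A).1 = n]]); split.
  move=> n; split; last by move=> _ [A [VA <-] <-]; have [] := pP A (Vm A VA).
  apply: finite_image.
  have [[A [VA An]]|none] := pselect (V `&` [set A | (p A).1 = n] !=set0).
    apply: sub_finite_set (finq (q A)) => D [VD Dn]; split=> //.
    by apply: sep => //; rewrite Dn An.
  by apply: sub_finite_set (finite_set0 _) => A VA; apply: none; exists A.
have VU n : [set (p A).2 | A in V `&` [set A | (p A).1 = n]] `<=` U n.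
  by move=> _ [A [VA <-] <-]; have [] := pP A (Vm A VA).
have cof (F : set X) : finite_set F ->
    exists2 A, (\bigcup_n [set (p A).2 | A in V `&` [set A | (p A).1 = n]]) A
      & F `<=` A.
  move=> finF; have [_ _ /(_ F finF)[A VA FA]] := oV; exists (p A).2.
    by exists (p A).1 => //; exists A.
  by have [_ eA] := pP A (Vm A VA); apply: subset_trans FA _; rewrite -{1}eA;
    exact: subIsetr.
split=> //; last first.
  by move=> [n _ /VU]; have [] := oU n.
split.
- apply: bigcup_countable => // n _; have [[cU _ _] _ _] := oU n.
  exact: sub_countable (subset_card_le (@VU n)) cU.
- by move=> A [n _ /VU]; have [[_ + _] _ _] := oU n; apply.
- rewrite -subTset => x _; have [A mA xA] := cof [set x] (finite_set1 x).
  by exists A => //; exact: xA.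
Qed.

Lemma ord2_neq0 (i : 'I_2) : i <> ord0 -> i = ord_max.
Proof.
by case: i => [[|[|//]] lti] ne0; apply/val_inj => //; case: ne0; exact/val_inj.
Qed.

Lemma omega_cover_colour (X : topologicalType) (U : set (set X))
    (g : set X -> 'I_2) :
  omega_cover U -> exists i, omega_cover (U `&` [set A | g A = i]).
Proof.
move=> oU; have [|||||] := @omega_cover_split X U
  (U `&` [set A | g A = ord0]) (U `&` [set A | g A = ord_max]).
- by [].
- by move=> A [].
- by move=> A [].
- move=> A UA; have [g0|g0] := pselect (g A = ord0); first by left.
  by right; split=> //; exact: ord2_neq0.
- by exists ord0.
- by exists ord_max.
Qed.

(* [c n] is the colour of almost all pairs {e_n, B}, as seen by the [W m]. *)
Lemma omega_cover_fusion (X : topologicalType) (U : set (set X))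
    (e : nat -> set X) (f : set (set X) -> 'I_2) : omega_cover U ->
  exists (W : nat -> set (set X)) (c : nat -> 'I_2),
    [/\ W 0 = U, forall n, omega_cover (W n),
        forall m n, m <= n -> W n `<=` W m &
        forall m n A, m < n -> W n A -> f [set e m; A] = c m].
Proof.
move=> oU.
have /choice[col colP] (p : set (set X) * nat) : exists i, omega_cover p.1 ->
    omega_cover (p.1 `&` [set A | f [set e p.2; A] = i]).
  have [op|nop] := pselect (omega_cover p.1); last by exists ord0.
  by have [i oi] := omega_cover_colour (fun A => f [set e p.2; A]) op; exists i.
pose fix W n := if n is m.+1
  then W m `&` [set A | f [set e m; A] = col (W m, m)] else U.
have Wdecr m n : m <= n -> W n `<=` W m.
  move=> /subnK <-; elim: (n - m) => [//|k IH] A [/IH]; exact.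
exists W, (fun n => col (W n, n)); split=> //.
- by elim=> [//|n IH]; exact: (colP (W n, n)).
- by move=> m n A mn /(Wdecr _ _ mn)[].
Qed.

Lemma arrow_of_Sfin (X : topologicalType) :
  Sfin_Omega_Omega X -> Omega_arrow_ceil_Omega X.
Proof.
move=> sfin U oU f; have [e rangee] := omega_cover_enum oU.
have [W [c [W0 oW Wdecr Wc]]] := omega_cover_fusion e f oU.
pose cls i : set (set X) := [set A | exists2 j, e j = A & c j = i].
(* As [W] decreases, a failure of [ord0] at [m] persists at [maxn m n]; splitting there gives
   [ord_max], which passes up to [n]. *)
have [i oWi] : exists i, forall n, omega_cover (W n `&` cls i).
  have [all0|/existsNP[m nm]] :=
    pselect (forall n, omega_cover (W n `&` cls ord0)).
    by exists ord0.
  exists ord_max => n; pose N := maxn m n.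
  have WN : W N `<=` (W N `&` cls ord0) `|` (W N `&` cls ord_max).
    move=> A WA; have : range e A by rewrite rangee -W0; exact: Wdecr WA.
    move=> [j _ ej]; have [c0|/ord2_neq0 c1] := pselect (c j = ord0).
      by left; split=> //; exists j.
    by right; split=> //; exists j.
  case: (omega_cover_split (oW N) (@subIsetl _ _ _) (@subIsetl _ _ _) WN) => oN.
    case: nm; apply: omega_cover_between (oW m) (@subIsetl _ _ _) oN _.
    by apply: setSI; apply: Wdecr; exact: leq_maxl.
  apply: omega_cover_between (oW n) (@subIsetl _ _ _) oN _.
  by apply: setSI; apply: Wdecr; exact: leq_maxr.
have [V [VP oV]] := sfin _ oWi.
have /choice[h hP] n : exists k, forall A, V n A ->
    exists j, [/\ j < k, e j = A & c j = i].
  have [finV Vn] := VP n.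
  have /choice[r rP] (A : set X) : exists j, V n A -> e j = A /\ c j = i.
    have [/Vn[_ [j ej cj]]|nV] := pselect (V n A); first by exists j.
    by exists 0.
  have [s rs] := (finite_seqP _).1 finV.
  exists (\max_(A <- s) r A).+1 => A VA; exists (r A).
  have [ej cj] := rP A VA; split=> //; rewrite ltnS.
  by apply: leq_bigmax_seq => //; move: VA; rewrite rs.
(* As [s k.+2] exceeds [h n] for every [n < s k.+1], the members of block [k]
   are listed in [e] before block [k.+2] starts, so that only adjacent blocks can
   fail to be homogeneous. *)
pose fix s k := if k is l.+1 then (s l + \sum_(n < s l) h n).+1 else 0.
have s_lt k : s k < s k.+1 by rewrite /= ltnS leq_addr.
have s_le k l : k <= l -> s k <= s l.
  by move=> /subnK <-; elim: (l - k) => [//|d /leq_trans]; apply; exact: ltnW.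
pose G k := \bigcup_(n in [set n | s k <= n < s k.+1]) V n.
have finG k : finite_set (G k).
  apply: bigcup_finite => [|n _]; last by have [] := VP n.
  by apply: sub_finite_set (finite_II (s k.+1)) => n /= /andP[].
have VG n A : V n A -> exists k, G k A.
  move=> VA; suff [k kn] : exists k, s k <= n < s k.+1 by exists k, n.
  elim: n {A VA} => [|n [k /andP[kn nk]]]; first by exists 0.
  have [nk1|nk1] := ltnP n.+1 (s k.+1).
    by exists k; rewrite nk1 ltnW.
  by exists k.+1; rewrite nk1 (leq_ltn_trans nk).
have homG k l A B : k.+1 < l -> G k A -> G l B -> f [set A; B] = i.
  move=> kl [n /= /andP[_ nk] /hP[j [jh <- <-]]] [m /= /andP[lm _] VB].
  have [_ /(_ B VB)[WB _]] := VP m.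
  (* Here [j < h n < s k.+2 <= s l <= m], so [B] in [W m] sees [e j] in colour [c j = i]. *)
  apply: Wc WB; apply: leq_trans lm; apply: leq_trans (s_le _ _ kl).
  apply: (leq_trans jh); rewrite [s k.+2]/= -/(s k.+1).
  rewrite (bigD1 (Ordinal nk))//= addnCA; apply: leqW; exact: leq_addr.
pose P b := \bigcup_(k in [set k | odd k = b]) G k.
have PU b : P b `<=` \bigcup_n V n.
  by move=> A [k _ [n _ VA]]; exists n.
have [b oP] : exists b, omega_cover (P b).
  have [|oP|oP] := omega_cover_split oV (PU true) (PU false).
  - move=> A [n _ /VG[k GA]]; rewrite /P.
    by case ok: (odd k); [left | right]; exists k.
  - by exists true.
  - by exists false.
(* Blocks may overlap, so [q] chooses one of parity [b]; its fibres lie inside the finite blocks. *)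
pose q A := xget 0 [set k | odd k = b /\ G k A].
have qP A : P b A -> odd (q A) = b /\ G (q A) A.
  by move=> [k kb GA]; rewrite /q; case: xgetP => // /(_ k)[].
exists i, (P b), q; split=> //.
- move=> A [k _ [n _ VA]]; have [_ /(_ A VA)[WA _]] := VP n.
  by rewrite -W0; exact: Wdecr WA.
- by move=> n; apply: sub_finite_set (finG n) => A [/qP[_ GA] <-].
- move=> A B /qP[qA GA] /qP[qB GB] /eqP qAB.
  have gap k l : odd k = b -> odd l = b -> k < l -> k.+1 < l by lia.
  move: qAB; rewrite neq_ltn => /orP[qAB|qBA].
    by apply: homG GA GB; exact: gap.
  by rewrite setUC; apply: homG GB GA; exact: gap.
Qed.

Theorem mainTheorem11 (X : topologicalType) :
  Omega_arrow_ceil_Omega X <-> Sfin_Omega_Omega X.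
Proof. by split; [exact: Sfin_of_arrow | exact: arrow_of_Sfin]. Qed.
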